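(* Let $\delta\in(0,n]$ and let $E\subset\mathbb R^n$ satisfy $\widetilde{\mathcal H}^\delta_\infty(E)<\infty$. Then there exist a subset $F\subset\mathbb R^n$ and an at most countable (possibly finite or empty) family $\{Q_j\}_j$ of non-overlapping dyadic cubes in $\mathbb R^n$ such that (i) $E\subset\left(\bigcup_j Q_j\right)\cup F$ and $\widetilde{\mathcal H}^\delta_\infty(F)=0$; (ii) $\sum_j\widetilde{\mathcal H}^\delta_\infty(Q_j)\le2\,\widetilde{\mathcal H}^\delta_\infty(E)$; (iii) for every $j$, $\widetilde{\mathcal H}^\delta_\infty(Q_j)\le3\,\widetilde{\mathcal H}^\delta_\infty(Q_j\cap E)$.
   Context: Dyadic cubes in $\mathbb R^n$ are the left-open right-closed cubes $\prod_{i=1}^n(2^{-k}m_i,2^{-k}(m_i+1)]$ with $k\in\mathbb Z$, $m\in\mathbb Z^n$; $l(Q)$ is the edge length of $Q$. For $E\subset\mathbb R^n$, the dyadic Hausdorff content is $\widetilde{\mathcal H}^\delta_\infty(E):=\inf\{\sum_i l(Q_i)^\delta:\ E\subset\bigcup_iQ_i\}$, the infimum over all finite or countable coverings of $E$ by dyadic cubes. Non-overlapping means pairwise disjoint. *)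

(* Defs.v *)
From HB Require Import structures.
From mathcomp Require Import all_boot all_order all_algebra.
From mathcomp Require Import all_classical all_reals all_analysis.

Set Implicit Arguments.
Unset Strict Implicit.
Unset Printing Implicit Defensive.

Import Order.TTheory GRing.Theory Num.Theory.

Local Open Scope classical_set_scope.
Local Open Scope ring_scope.

(* The pair (k, m) encodes the cube prod_i (2^-k m_i, 2^-k (m_i + 1)].  The
   encoding is injective on cubes as soon as n > 0, so that reading the edge
   length off the code is unambiguous. *)
Definition dyadic (n : nat) : Type := (int * 'rV[int]_n)%type.

Definition edge (R : realType) (n : nat) (q : dyadic n) : R := 2 ^ (- q.1).

Definition cube (R : realType) (n : nat) (q : dyadic n) : set 'rV[R]_n :=
  [set x | forall i : 'I_n,
     edge R q * (q.2 ord0 i)%:~R < x ord0 i <= edge R q * (q.2 ord0 i + 1)%:~R].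
Arguments cube R {n} q.

(* Finite or countable (possibly empty) families of cubes are indexed by an
   arbitrary set J of natural numbers; the values of Q outside J are ignored. *)
Definition dyadic_content (R : realType) (n : nat) (delta : R)
    (E : set 'rV[R]_n) : \bar R :=
  ereal_inf [set s : \bar R | exists (J : set nat) (Q : nat -> dyadic n),
    E `<=` \bigcup_(i in J) cube R (Q i) /\
    s = (\esum_(i in J) (edge R (Q i) `^ delta)%:E)%E].

(* Main.v *)
Require Import Defs.
From HB Require Import structures.
From mathcomp Require Import all_boot all_order all_algebra.
From mathcomp Require Import all_classical all_reals all_analysis.
From mathcomp Require Import zify ring lra.

Set Implicit Arguments.
Unset Strict Implicit.
Unset Printing Implicit Defensive.

Import Order.TTheory GRing.Theory Num.Theory.

Local Open Scope classical_set_scope.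
Local Open Scope ring_scope.

(** Write H for the dyadic content and call a cube Q good when
    l(Q)^delta <= 3 H(Q `&` E); as H(Q) <= l(Q)^delta, good cubes satisfy the
    density condition asked of the Q_j.  If H(E) = 0, take F = E and no cube.
    Otherwise start from a covering T_0 of E whose total l^delta is at most
    (6/5) H(E).  Over a cube Q that is not good,
    H(Q `&` E) < l(Q)^delta / 3, so Q `&` E has a covering of total
    l^delta at most (2/5) l(Q)^delta (bad_cover).  Let T_{k+1} be the union of
    these coverings over the cubes of T_k that are not good.  The total of T_k
    is then at most (6/5) (2/5)^k H(E), and the sum over k of these bounds is
    exactly 2 H(E).  Let U consist of the good cubes of all the T_k.  A point
    of E lying in no cube of U is passed on from T_k to T_{k+1} for ever, so
    the set F of these points is covered by every T_k and has content zero
    (stopping_cover).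

    Nothing in this construction makes the cubes of U disjoint, and nothing
    has to: passing to the maximal cubes of U at the very end only lowers the
    sum and leaves the union unchanged.  Maximal cubes exist because a family
    of finite total has bounded edges, and they are disjoint because dyadic
    cubes are nested or disjoint (disjoint_subfamily).

    Families of cubes are handled throughout as sets of codes, which form a
    countable type, so that indexing by natural numbers only occurs at the
    interface with the definition of the content. *)

(** * Unordered sums *)

Lemma le_esum_subset (R : realType) (T : choiceType) (A B : set T)
    (a : T -> \bar R) :
  A `<=` B -> (\esum_(x in A) a x <= \esum_(x in B) a x)%E.
Proof.
move=> AB; apply: ge_ereal_sup => _ [X [finX XA] <-].
by apply: ereal_sup_ubound; exists X => //; split => // x /XA /AB.
Qed.

(** Countable subadditivity, without any disjointness: assigning to each point
    of [A] one index that covers it embeds [A] into the disjoint union of the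
    [B k].  Singletons [B k] give the comparison along a non-injective
    reindexing. *)
Lemma esum_cover_le (R : realType) (I T : choiceType) (K : set I)
    (B : I -> set T) (A : set T) (a : T -> \bar R) :
  (forall x, (0 <= a x)%E) -> A `<=` \bigcup_(k in K) B k ->
  (\esum_(x in A) a x <= \esum_(k in K) \esum_(x in B k) a x)%E.
Proof.
move=> a0 AB; have [->|/set0P[x0 Ax0]] := eqVneq A set0.
  by rewrite esum_set0; apply: esum_ge0 => k _; exact: esum_ge0.
have [k0 _ _] := AB _ Ax0.
have /choice[i iP] (x : T) : exists k, A x -> K k /\ B k x.
  have [Ax|nAx] := pselect (A x); last by exists k0.
  by have [k Kk Bkx] := AB _ Ax; exists k.
rewrite esum_esum// -(@esum_image _ _ _ A (fun x => (i x, x)) (fun y => a y.2)).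
  by apply: le_esum_subset => _ [x Ax <-]; have [] := iP x Ax.
by move=> x y _ _ [].
Qed.

Lemma esumZ_le (R : realType) (T : choiceType) (A : set T) (c : R)
    (a : T -> \bar R) : 0 <= c -> (forall x, (0 <= a x)%E) ->
  (\esum_(x in A) (c%:E * a x) <= c%:E * \esum_(x in A) a x)%E.
Proof.
move=> c0 a0; apply: ge_ereal_sup => _ [X XA <-].
rewrite -ge0_mule_fsumr//; apply: lee_wpmul2l; first by rewrite lee_fin.
by apply: ereal_sup_ubound; exists X.
Qed.

(** * The content in terms of sets of codes *)

HB.instance Definition _ (n : nat) :=
  Countable.copy (dyadic n) (int * 'rV[int]_n)%type.

Lemma dyadic_enum (n : nat) (A : set (dyadic n)) :
  exists (J : set nat) (Q : nat -> dyadic n), set_bij J A Q.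
Proof.
pose Q (i : nat) : dyadic n := odflt (0, 0) (unpickle i).
have pickleQ (q : dyadic n) : Q (pickle q) = q.
  by rewrite /Q pickleK.
exists [set pickle q | q in A], Q; split.
- by move=> _ [q Aq <-]; rewrite pickleQ.
- move=> _ _ /set_mem[q Aq <-] /set_mem[q' Aq' <-].
  by rewrite !pickleQ => ->.
- by move=> q Aq; exists (pickle q); [exists q|].
Qed.

Section Content.
Variables (R : realType) (n : nat) (delta : R).
Implicit Types (A B U V : set (dyadic n)) (E F : set 'rV[R]_n) (q : dyadic n).

Definition weight q : \bar R := (edge R q `^ delta)%:E.
Definition mass A : \bar R := \esum_(q in A) weight q.

Definition union_cubes A : set 'rV[R]_n := \bigcup_(q in A) cube R q.

Lemma edge_gt0 q : 0 < edge R q.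
Proof. by rewrite /edge exprz_gt0. Qed.

Lemma weight_gt0 q : (0 < weight q)%E.
Proof. by rewrite lte_fin powR_gt0 ?edge_gt0. Qed.

Lemma weight_ge0 q : (0 <= weight q)%E.
Proof. exact/ltW/weight_gt0. Qed.

Lemma le_mass A B : A `<=` B -> (mass A <= mass B)%E.
Proof. exact: le_esum_subset. Qed.

Lemma mass_ge0 A : (0 <= mass A)%E.
Proof. by apply: esum_ge0 => q _; exact: weight_ge0. Qed.

Lemma content_ge0 E : (0 <= dyadic_content delta E)%E.
Proof.
apply: le_ereal_inf_tmp => _ [J [Q [_ ->]]].
by apply: esum_ge0 => i _; exact: weight_ge0.
Qed.

Lemma content_le_mass E A :
  E `<=` union_cubes A -> (dyadic_content delta E <= mass A)%E.
Proof.
move=> EA; have [J [Q QA]] := dyadic_enum A.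
apply: ereal_inf_lbound; exists J, Q; split.
  move=> x /EA[q Aq qx]; have [_ _ surjQ] := QA.
  by have [j Jj jq] := surjQ _ Aq; exists j => //; rewrite jq.
exact: (@reindex_esum R nat (dyadic n) J A Q).
Qed.

Lemma content_cube_le q : (dyadic_content delta (cube R q) <= weight q)%E.
Proof.
rewrite -(@esum_set1 R (dyadic n) q weight) ?weight_ge0//.
by apply: content_le_mass => x qx; exists q.
Qed.

Lemma content_lt_cover E (s : \bar R) : (dyadic_content delta E < s)%E ->
  exists A, E `<=` union_cubes A /\ (mass A < s)%E.
Proof.
move=> /ereal_inf_lt[_ [J [Q [EQ ->]]] lts]; exists (Q @` J); split.
  by move=> x /EQ[j Jj Qjx]; exists (Q j) => //; exists j.
apply: le_lt_trans lts.
have weightQ j : weight (Q j) = mass [set Q j].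
  by rewrite /mass esum_set1// weight_ge0.
under eq_esum do rewrite -/(weight _) weightQ.
apply: esum_cover_le => [q|_ [j Jj <-]]; first exact: weight_ge0.
by exists j.
Qed.

(** * Dyadic cubes are nested or disjoint *)

Lemma edge_ratio q q' (d : nat) : q.1 = q'.1 + d%:Z ->
  edge R q' = (2 ^ d)%:R * edge R q.
Proof.
move=> qE; rewrite /edge qE natrX exprnP -expfzDr ?pnatr_eq0//.
by congr (_ ^ _); rewrite opprD addrCA subrr addr0.
Qed.

(** Only integer inequalities matter: in units of the smaller edge both cubes
    have integer corners, and a half-open unit interval that meets a half-open
    interval with integer endpoints lies inside it. *)
Lemma cube_nested q q' : q'.1 <= q.1 ->
  cube R q `&` cube R q' !=set0 -> cube R q `<=` cube R q'.
Proof.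
move=> le_q [x [qx q'x]] y qy i.
pose d := absz (q.1 - q'.1).
have dE : q.1 = q'.1 + d%:Z by rewrite /d; lia.
have := edge_ratio dE; move: (qx i) (q'x i) (qy i).
move: (edge R q) (edge R q') (edge_gt0 q) => l l' l0.
set m := q.2 ord0 i; set m' := q'.2 ord0 i.
move=> /andP[x1 x2] /andP[x3 x4] /andP[y1 y2] l'E.
have lE (k : int) : l' * k%:~R = l * ((2 ^ d)%:Z * k)%:~R.
  by rewrite l'E intrM -pmulrn mulrCA -mulrA mulrC.
have lt_int (a b : int) : l * a%:~R < l * b%:~R -> a < b.
  by rewrite ltr_pM2l// ltr_int.
have le_int (a b : int) : a <= b -> l * a%:~R <= l * b%:~R.
  by move=> ab; rewrite ler_pM2l// ler_int.
rewrite lE in x3; rewrite lE in x4; rewrite !lE.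
have ltR := lt_int _ _ (lt_le_trans x1 x4).
have ltL := lt_int _ _ (lt_le_trans x3 x2).
apply/andP; split.
- by apply: le_lt_trans y1; apply: le_int; lia.
- by apply: le_trans y2 _; apply: le_int; lia.
Qed.

Lemma cube_eq q q' : q.1 = q'.1 ->
  cube R q `&` cube R q' !=set0 -> q = q'.
Proof.
case: q q' => k m [k' m'] /= kk' [x [qx q'x]]; subst k'.
congr (_, _); apply/rowP => i; move: (qx i) (q'x i) => /=.
move=> /andP[x1 x2] /andP[x3 x4].
have e0 := edge_gt0 (k, m).
have lt_int (a b : int) : edge R (k, m) * a%:~R < edge R (k, m) * b%:~R -> a < b.
  by rewrite ltr_pM2l// ltr_int.
have := lt_int _ _ (lt_le_trans x1 x4).
have := lt_int _ _ (lt_le_trans x3 x2).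
suff: m ord0 i < m' ord0 i + 1 -> m' ord0 i < m ord0 i + 1 ->
    m ord0 i = m' ord0 i by move=> + ltL ltR; exact.
lia.
Qed.

(** * Maximal cubes *)

(** No cube of the family can have l^delta above the total mass, which bounds
    its edge 2^-k, hence its level k from below. *)
Lemma mass_fin_level U : 0 < delta -> (mass U < +oo)%E ->
  exists b : nat, forall q, U q -> - b%:Z <= q.1.
Proof.
move=> delta0 massU.
have massE : mass U = (fine (mass U))%:E by rewrite fineK// ge0_fin_numE ?mass_ge0.
set M := fine (mass U) in massE.
have M0 : 0 <= M by rewrite fine_ge0 ?mass_ge0.
exists (Num.bound (M `^ delta^-1)) => q Uq; rewrite leNgt; apply/negP => qb.
set b := Num.bound _ in qb.
have weightM : edge R q `^ delta <= M.
  rewrite -lee_fin -massE -/(weight q).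
  rewrite -(@esum_set1 R (dyadic n) q weight) ?weight_ge0//.
  by apply: le_mass => _ ->.
have edgeM : edge R q <= M `^ delta^-1.
  rewrite -[leLHS]powRr1 ?(ltW (edge_gt0 q))// -(divff (lt0r_neq0 delta0)) powRrM.
  by apply: ge0_ler_powR; rewrite ?invr_ge0 ?nnegrE ?powR_ge0// ltW.
have bE : M `^ delta^-1 < b%:R by apply: archi_boundP; exact: powR_ge0.
have : (b%:R : R) <= edge R q.
  have [d dE] : exists d : nat, - q.1 = d%:Z /\ (b <= d)%N.
    by exists (absz q.1); lia.
  case: dE => dE bd; rewrite /edge dE -exprnP -natrX ler_nat.
  by apply: leq_trans bd _; exact/ltnW/ltn_expl.
by rewrite leNgt (le_lt_trans edgeM bE).
Qed.

(** [V] consists of the cubes of [U] that no larger cube of [U] meets. *)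
Lemma disjoint_subfamily U : 0 < delta -> (mass U < +oo)%E ->
  exists V, [/\ V `<=` U, union_cubes U `<=` union_cubes V &
    forall q q', V q -> V q' -> cube R q `&` cube R q' !=set0 -> q = q'].
Proof.
move=> delta0 /(mass_fin_level delta0)[b Ub].
exists [set q | U q /\ forall q', U q' ->
  cube R q `&` cube R q' !=set0 -> q.1 <= q'.1]; split.
- by move=> q [].
- have up (d : nat) : forall q, U q -> q.1 + b%:Z <= d%:Z -> exists2 q', U q' /\
      (forall q'', U q'' -> cube R q' `&` cube R q'' !=set0 -> q'.1 <= q''.1) &
      cube R q `<=` cube R q'.
    (* Climb to larger and larger cubes; [q.1 + b] bounds the number of
       steps left. *)
    elim: d => [|d IH] q Uq qd.
      by exists q => //; split => // q' Uq' _; have := Ub _ Uq'; lia.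
    have [//|] := pselect (forall q', U q' ->
      cube R q `&` cube R q' !=set0 -> q.1 <= q'.1); first by exists q.
    move=> /existsNP[q' /not_implyP[Uq' /not_implyP[qq' /negP]]].
    rewrite -ltNge => q'q; have [|q0 q0max q'q0] := IH _ Uq'; first by lia.
    by exists q0 => //; apply: subset_trans q'q0; apply: cube_nested => //; exact: ltW.
  move=> x [q Uq qx].
  have [|q' q'max qq'] := up (absz (q.1 + b%:Z)) q Uq; first by lia.
  by exists q' => //; exact: qq'.
- move=> q q' [Uq qmax] [Uq' q'max] qq'; apply: cube_eq => //.
  apply: le_anti; rewrite qmax// q'max//.
  by case: qq' => x [? ?]; exists x.
Qed.

(** * The stopping-time construction *)

(** The condition bears on l^delta instead of the content of the cube, so that
    its failure directly bounds the cost of covering the part of [E] in the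
    cube by the quantity that is summed. *)
Definition good E : set (dyadic n) :=
  [set q | (weight q <= 3%:E * dyadic_content delta (cube R q `&` E))%E].

Lemma bad_cover E q : ~ good E q ->
  exists A, cube R q `&` E `<=` union_cubes A /\ (mass A <= (2 / 5)%:E * weight q)%E.
Proof.
move=> /negP; rewrite -ltNge => bad.
have /content_lt_cover[A [EA massA]] :
    (dyadic_content delta (cube R q `&` E) < (2 / 5)%:E * weight q)%E.
  have := content_ge0 (cube R q `&` E); have := weight_gt0 q; move: bad.
  rewrite /weight; case: (dyadic_content _ _) => [c| |] //.
    by rewrite -!EFinM !lte_fin lee_fin; lra.
  by rewrite gt0_muley// ltNge leey.
by exists A; split => //; exact: ltW.
Qed.

(** The constants are tuned to (6 / 5) / (1 - 2 / 5) = 2 with 1 / 3 < 2 / 5: the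
    second inequality is the slack needed in [bad_cover]. *)
Lemma stopping_cover E (h : R) :
  dyadic_content delta E = h%:E -> 0 < h ->
  exists U, [/\ U `<=` good E, (mass U <= 2%:E * h%:E)%E &
    dyadic_content delta (E `\` union_cubes U) = 0%E].
Proof.
move=> Eh h0.
have [A0 [EA0 massA0]] : exists A, E `<=` union_cubes A /\ (mass A < (6 / 5 * h)%:E)%E.
  by apply: content_lt_cover; rewrite Eh lte_fin; lra.
have /choice[c cP] q : exists A, ~ good E q ->
    cube R q `&` E `<=` union_cubes A /\ (mass A <= (2 / 5)%:E * weight q)%E.
  by have [gq|/bad_cover[A AP]] := pselect (good E q); [exists set0|exists A].
pose T := fix T k := if k is k'.+1
  then \bigcup_(q in T k' `\` good E) c q else A0.
have massT k : (mass (T k) <= (geometric (6 / 5 * h) (2 / 5) k)%:E)%E.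
  elim: k => [|k IH]; first by rewrite /= expr0 mulr1 ltW.
  have -> : geometric (6 / 5 * h) (2 / 5) k.+1 =
      2 / 5 * geometric (6 / 5 * h) (2 / 5) k by rewrite /= exprS mulrCA.
  rewrite EFinM; apply: le_trans (lee_wpmul2l _ IH); last by rewrite lee_fin; lra.
  have step : (mass (T k.+1) <=
      \esum_(q in T k `\` good E) mass (c q))%E.
    by apply: esum_cover_le => // q; exact: weight_ge0.
  apply: (le_trans step).
  apply: le_trans (esumZ_le _ _ _); [|by lra|by move=> q; exact: weight_ge0].
  apply: (@le_trans _ _ (\esum_(q in T k `\` good E)
      ((2 / 5)%:E * weight q))%E).
    by apply: le_esum => q [_ /cP[]].
  by apply: le_esum_subset => q [].
pose U := \bigcup_k (T k `&` good E).
exists U; split.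
- by move=> q [k _ []].
- apply: (@le_trans _ _ (\esum_(k in [set: nat]) mass (T k))).
    apply: esum_cover_le => [q|q [k _ [Tkq _]]]; first exact: weight_ge0.
    by exists k.
  apply: (@le_trans _ _ (\esum_(k in [set: nat])
      (geometric (6 / 5 * h) (2 / 5) k)%:E)); first exact: le_esum.
  rewrite -nneseries_esumT; last first.
    by move=> k; rewrite lee_fin geometric_ge0//; lra.
  apply: lime_le; first by apply: is_cvg_nneseries => k _ _;
    rewrite lee_fin geometric_ge0//; lra.
  apply: nearW => k; rewrite sumEFin -EFinM lee_fin.
  rewrite -[X in _ <= X](_ : 6 / 5 * h * (1 - 2 / 5)^-1 = _); last by field.
  by apply: geometric_le_lim; rewrite ?ger0_norm; lra.
- have FT k : E `\` union_cubes U `<=` union_cubes (T k).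
    elim: k => [|k IH] x [Ex nUx]; first exact: EA0.
    have [q Tq qx] := IH x (conj Ex nUx).
    have nGq : ~ good E q by move=> Gq; apply: nUx; exists q => //; exists k.
    have [cq _] := cP q nGq.
    by have [q' cq' q'x] := cq x (conj qx Ex); exists q' => //; exists q.
  apply/eqP; rewrite eq_le content_ge0 andbT.
  have cvgT : (geometric (6 / 5 * h) (2 / 5) k)%:E @[k --> \oo] --> (0 : \bar R).
    by apply: cvg_EFin; [exact: nearW|apply: cvg_geometric; rewrite ger0_norm; lra].
  rewrite -(cvg_lim _ cvgT)//; apply: lime_ge; first by apply/cvg_ex; exists 0%E.
  apply: nearW => k; exact: le_trans (content_le_mass (FT k)) (massT k).
Qed.

End Content.

Theorem proposition2p10 (R : realType) (n : nat) (delta : R)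
    (E : set 'rV[R]_n)
    (delta_gt0 : 0 < delta) (delta_le_n : delta <= n%:R)
    (contentE_fin : (dyadic_content delta E < +oo)%E) :
  exists (F : set 'rV[R]_n) (J : set nat) (Q : nat -> dyadic n),
    [/\ trivIset J (fun j => cube R (Q j)),
        E `<=` (\bigcup_(j in J) cube R (Q j)) `|` F /\
        dyadic_content delta F = 0%E,
        (\esum_(j in J) dyadic_content delta (cube R (Q j))
           <= 2%:E * dyadic_content delta E)%E
      & forall j, J j ->
        (dyadic_content delta (cube R (Q j))
           <= 3%:E * dyadic_content delta (cube R (Q j) `&` E))%E].
Proof.
have [E0|Epos] := eqVneq (dyadic_content delta E) 0%E.
  exists E, set0, (fun=> (0, 0)); split => //.
  by rewrite esum_set0 E0 mule0.
have content_fin : dyadic_content delta E \is a fin_num.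
  by rewrite ge0_fin_numE ?content_ge0.
have [] := @stopping_cover R n delta E (fine (dyadic_content delta E)).
- by rewrite fineK.
- by rewrite fine_gt0// contentE_fin lt0e Epos content_ge0.
move=> U []; rewrite fineK// => Ugood massU restU.
have [|V [VU unionV Vdisj]] := disjoint_subfamily delta_gt0 (U := U).
  by apply: le_lt_trans massU _; rewrite -(fineK content_fin) -EFinM ltry.
have [J [Q QV]] := dyadic_enum V; have [QJ Qinj Qsurj] := QV.
exists (E `\` union_cubes U), J, Q; split.
- move=> i j Ji Jj QiQj; apply: Qinj; rewrite ?inE//.
  by apply: Vdisj QiQj; exact: QJ.
- split => // x Ex; have [/unionV[q Vq qx]|nUx] := pselect (union_cubes U x).
    by left; have [j Jj jq] := Qsurj _ Vq; exists j => //; rewrite jq.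
  by right.
- apply: le_trans massU; apply: le_trans (le_mass delta VU).
  rewrite /mass (reindex_esum J V Q _ QV).
  by apply: le_esum => j _; exact: content_cube_le.
- move=> j Jj; apply: le_trans (content_cube_le _ _) _.
  exact: (Ugood _ (VU _ (QJ _ Jj))).
Qed.
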